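(* Let $Q$ be a $\rho\times N$ integer matrix, let $s\in\mathbb{R}^\rho$, and let $X=\mu_Q^{-1}(s)/U(1)^\rho$ and $\mathbb{X}=(\mathbb{C}^N\setminus E)/(\mathbb{C}^* )^\rho$, where $E$ is the complement of $(\mathbb{C}^* )^N\star\mu_Q^{-1}(s)$ in $\mathbb{C}^N$. Then the natural map $X\to\mathbb{X}$, sending the $U(1)^\rho$-orbit of $z\in\mu_Q^{-1}(s)$ to the $(\mathbb{C}^* )^\rho$-orbit of $z$, is injective.
   Context: The group $(\mathbb{C}^* )^\rho$ acts on $\mathbb{C}^N$ by $\lambda\star z=(\lambda_1^{Q_{11}}\cdots\lambda_\rho^{Q_{\rho 1}}z_1,\dots,\lambda_1^{Q_{1N}}\cdots\lambda_\rho^{Q_{\rho N}}z_N)$, and $U(1)^\rho\subset(\mathbb{C}^* )^\rho$ acts by restriction. $(\mathbb{C}^* )^N$ acts on $\mathbb{C}^N$ by coordinatewise multiplication, also denoted $\star$. The moment map is $\mu_Q=Q\circ\mu:\mathbb{C}^N\to\mathbb{R}^\rho$, where $\mu:\mathbb{C}^N\to\mathbb{R}^N$, $\mu(z)=\frac12(|z_1|^2,\dots,|z_N|^2)$. No regularity of $s$ and no compactness of $X$ is assumed. $\mathbb{X}$ is the set of $(\mathbb{C}^* )^\rho$-orbits on $\mathbb{C}^N\setminus E=(\mathbb{C}^* )^N\star\mu_Q^{-1}(s)$. *)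

(* Defs.v *)
From mathcomp Require Import all_boot all_order all_algebra.
From mathcomp Require Import complex.
From mathcomp Require Import classical_sets boolp functions reals.

Set Implicit Arguments.
Unset Strict Implicit.
Unset Printing Implicit Defensive.

Import Order.TTheory GRing.Theory Num.Theory.
Local Open Scope classical_set_scope.
Local Open Scope ring_scope.
Local Open Scope complex_scope.

Section Toric.
Variable R : realType.

Definition Cstar (n : nat) : set 'cV[R[i]]_n :=
  [set l : 'cV[R[i]]_n | forall a, l a 0 != 0].

Definition U1 (n : nat) : set 'cV[R[i]]_n :=
  [set l : 'cV[R[i]]_n | forall a, `|l a 0| = 1].

Variables rho N : nat.

Definition coord_act (t z : 'cV[R[i]]_N) : 'cV[R[i]]_N :=
  \col_j (t j 0 * z j 0).

(* Integer powers are total ([0 ^ m] is [0] for [m < 0]); this is an action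
   only for [l] in [Cstar rho]. *)
Definition torus_act (Q : 'M[int]_(rho, N)) (l : 'cV[R[i]]_rho)
    (z : 'cV[R[i]]_N) : 'cV[R[i]]_N :=
  \col_j ((\prod_(a < rho) l a 0 ^ Q a j) * z j 0).

(* [normc] is the R-valued modulus; the norm of R[i] takes values in R[i]. *)
Definition moment (z : 'cV[R[i]]_N) : 'cV[R]_N :=
  \col_j (2^-1 * ComplexField.Normc.normc (z j 0) ^+ 2).

Definition momentQ (Q : 'M[int]_(rho, N)) (z : 'cV[R[i]]_N) : 'cV[R]_rho :=
  map_mx intr Q *m moment z.

Definition level (Q : 'M[int]_(rho, N)) (s : 'cV[R]_rho) : set 'cV[R[i]]_N :=
  momentQ Q @^-1` [set s].

Definition unstable (Q : 'M[int]_(rho, N)) (s : 'cV[R]_rho) :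
    set 'cV[R[i]]_N :=
  ~` [set coord_act t z | t in @Cstar N & z in level Q s].

Definition torus_orbit (Q : 'M[int]_(rho, N)) (G : set 'cV[R[i]]_rho)
    (z : 'cV[R[i]]_N) : set 'cV[R[i]]_N :=
  [set torus_act Q l z | l in G].

Definition symplectic_quotient (Q : 'M[int]_(rho, N)) (s : 'cV[R]_rho) :
    set (set 'cV[R[i]]_N) :=
  [set torus_orbit Q (@U1 rho) z | z in level Q s].

Definition git_quotient (Q : 'M[int]_(rho, N)) (s : 'cV[R]_rho) :
    set (set 'cV[R[i]]_N) :=
  [set torus_orbit Q (@Cstar rho) z | z in ~` unstable Q s].

Lemma U1_Cstar (n : nat) : @U1 n `<=` @Cstar n.
Proof. by move=> l hl a; rewrite -normr_gt0 hl. Qed.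

Lemma torus_act1 (Q : 'M[int]_(rho, N)) z : torus_act Q (const_mx 1) z = z.
Proof.
apply/colP => j; rewrite mxE big1 ?mul1r// => a _.
by rewrite mxE exp1rz.
Qed.

Lemma torus_actM (Q : 'M[int]_(rho, N)) l m z :
  torus_act Q l (torus_act Q m z) = torus_act Q (\col_a (l a 0 * m a 0)) z.
Proof.
apply/colP => j; rewrite !mxE mulrA -big_split/=; congr (_ * _).
by apply: eq_bigr => a _; rewrite mxE expfzMl.
Qed.

Lemma level_stable (Q : 'M[int]_(rho, N)) s : level Q s `<=` ~` unstable Q s.
Proof.
move=> z hz; rewrite /unstable setCK; exists (const_mx 1).
  by move=> a; rewrite mxE oner_neq0.
by exists z => //; apply/colP => j; rewrite !mxE mul1r.
Qed.

Lemma saturation_U1_orbit (Q : 'M[int]_(rho, N)) z :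
  \bigcup_(w in torus_orbit Q (@U1 rho) z) torus_orbit Q (@Cstar rho) w =
  torus_orbit Q (@Cstar rho) z.
Proof.
apply/seteqP; split=> [w [_ [m hm <-] [l hl <-]]|w hw].
  rewrite torus_actM; exists (\col_a (l a 0 * m a 0)) => // a.
  by rewrite mxE mulf_neq0 ?hl ?(U1_Cstar hm).
exists z => //; exists (const_mx 1); last exact: torus_act1.
by move=> a; rewrite mxE normr1.
Qed.

Lemma saturation_git_quotient (Q : 'M[int]_(rho, N)) s
    (O : symplectic_quotient Q s) :
  \bigcup_(w in set_val O) torus_orbit Q (@Cstar rho) w \in git_quotient Q s.
Proof.
apply/mem_set; have /= [z hz eO] :
  symplectic_quotient Q s (set_val O) := set_valP O.
rewrite -eO saturation_U1_orbit; exists z => //; exact: level_stable.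
Qed.

(* The natural map sends a U(1)^rho-orbit to its saturation under the complex
   torus; [natural_mapE] shows that this is the map [z]_U |-> [z]_C. *)
Definition natural_map (Q : 'M[int]_(rho, N)) (s : 'cV[R]_rho)
    (O : symplectic_quotient Q s) : git_quotient Q s :=
  SigSub (saturation_git_quotient O).

Lemma natural_mapE (Q : 'M[int]_(rho, N)) s (O : symplectic_quotient Q s) z :
  set_val O = torus_orbit Q (@U1 rho) z ->
  set_val (natural_map O) = torus_orbit Q (@Cstar rho) z.
Proof. by move=> eO; rewrite /= set_valE/= -saturation_U1_orbit -eO. Qed.

End Toric.

Arguments natural_map {R rho N} Q s O.

(* Main.v *)
Require Import Defs.
From mathcomp Require Import all_boot all_order all_algebra.
From mathcomp Require Import complex.
From mathcomp Require Import classical_sets boolp functions reals.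
From mathcomp Require Import exp.

(** Let [w = l * z] with [z] and [w] on the same level, and let
    [c_j = prod_a |l_a|^(Q_aj)], so that [|w_j| = c_j |z_j|].  Pairing
    [momentQ w - momentQ z = 0] with the vector [(ln |l_a|)_a] gives
    [sum_j ln c_j * (c_j^2 - 1) * |z_j|^2 / 2 = 0].  Every summand is
    nonnegative, hence [c_j = 1] whenever [z_j <> 0], and therefore [w = u * z]
    for the phase [u_a = l_a / |l_a|]. *)

Set Implicit Arguments.
Unset Strict Implicit.
Unset Printing Implicit Defensive.

Import Order.TTheory GRing.Theory Num.Theory.
Import ComplexField.Normc.
Local Open Scope classical_set_scope.
Local Open Scope ring_scope.
Local Open Scope complex_scope.

Lemma ln_exprz (R : realType) (x : R) (m : int) :
  0 < x -> ln (x ^ m) = m%:~R * ln x.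
Proof.
move=> x0; case: m => n; first by rewrite -exprnP lnXn// mulr_natl.
by rewrite NegzE -exprnN lnV ?posrE ?exprn_gt0// lnXn// intrN mulNr mulr_natl.
Qed.

Lemma ln_prod (R : realType) (I : Type) (t : seq I) (F : I -> R) :
  (forall i, 0 < F i) -> ln (\prod_(i <- t) F i) = \sum_(i <- t) ln (F i).
Proof.
move=> F0; elim: t => [|i t IH]; first by rewrite !big_nil ln1.
by rewrite !big_cons lnM ?posrE ?prodr_gt0// IH.
Qed.

(** Both factors change sign exactly at [c = 1], and in the same direction. *)
Lemma ln_mul_sqrB1_ge0 (R : realType) (c : R) :
  0 < c -> 0 <= ln c * (c ^+ 2 - 1).
Proof.
move=> c0; case: (lerP 1 c) => c1.
  by rewrite mulr_ge0 ?ln_ge0// subr_ge0 exprn_ege1.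
by rewrite mulr_le0 ?ln_le0 ?(ltW c1)// subr_le0 exprn_ile1 ?ltW.
Qed.

Lemma ln_mul_sqrB1_eq0 (R : realType) (c : R) :
  0 < c -> (ln c * (c ^+ 2 - 1) == 0) = (c == 1).
Proof.
by move=> c0; rewrite mulf_eq0 ln_eq0// subr_eq0 sqrp_eq1 ?ltW// orbb.
Qed.

(** The real core of the argument: [r] will be the moduli of a torus element and [x] the moment of a
    point, so that [c j] is the modulus of the [j]-th character. *)
Lemma scaling_fixing_image (R : realType) (rho N : nat) (Q : 'M[int]_(rho, N))
    (r : 'I_rho -> R) (x : 'cV[R]_N) (c := fun j => \prod_a r a ^ Q a j) :
    (forall a, 0 < r a) -> (forall j, 0 <= x j 0) ->
    map_mx intr Q *m (\col_j (c j ^+ 2 * x j 0)) = map_mx intr Q *m x ->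
  forall j, c j = 1 \/ x j 0 = 0.
Proof.
move=> r0 x0 /eqP; rewrite -subr_eq0 -mulmxBr => /eqP eQ.
have c0 j : 0 < c j by apply: prodr_gt0 => a _; rewrite exprz_gt0.
have lnc j : ln (c j) = \sum_a (Q a j)%:~R * ln (r a).
  rewrite ln_prod => [|a]; last by rewrite exprz_gt0.
  by apply: eq_bigr => a _; rewrite ln_exprz.
have sum0 : \sum_j ln (c j) * (c j ^+ 2 - 1) * x j 0 = 0.
  (* By [lnc], the row of logarithms times [Q] has entries [ln (c j)]; the vector it is paired with
     vanishes by [eQ]. *)
  transitivity (((\row_a ln (r a)) *m
      (map_mx intr Q *m (\col_j (c j ^+ 2 * x j 0) - x))) 0 0).
    rewrite mulmxA mxE; apply: eq_bigr => j _.
    rewrite !mxE lnc -mulrA mulrBl mul1r; congr (_ * _).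
    by apply: eq_bigr => a _; rewrite !mxE mulrC.
  by rewrite eQ mulmx0 mxE.
move=> j; have /eqP : ln (c j) * (c j ^+ 2 - 1) * x j 0 = 0.
  by apply: (psumr_eq0P _ sum0) => // i _; rewrite mulr_ge0 ?ln_mul_sqrB1_ge0.
by rewrite mulf_eq0 ln_mul_sqrB1_eq0// => /orP[] /eqP; [left|right].
Qed.

Lemma normfXz (F : numFieldType) (x : F) (m : int) : `|x ^ m| = `|x| ^ m.
Proof.
by case: m => n; rewrite ?NegzE -?exprnP -?exprnN ?normfV normrX.
Qed.

Section Orbits.
Variables (R : realType) (rho N : nat) (Q : 'M[int]_(rho, N)).
Implicit Types (l : 'cV[R[i]]_rho) (z : 'cV[R[i]]_N) (s : 'cV[R]_rho).

Lemma normc_character l j :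
  normc (\prod_a l a 0 ^ Q a j) = \prod_a normc (l a 0) ^ Q a j.
Proof.
(* Embedded in [R[i]], [normc] becomes the norm, which is multiplicative there. *)
apply: complexI; rewrite -[LHS]/(`|\prod_a l a 0 ^ Q a j|).
rewrite normr_prod rmorph_prod; apply: eq_bigr => a _.
by rewrite fmorphXz/= normfXz.
Qed.

Lemma level_phase s l z :
    Cstar l -> level Q s z -> level Q s (torus_act Q l z) ->
  torus_act Q l z = torus_act Q (\col_a (l a 0 / `|l a 0|)) z.
Proof.
move=> l0 zs lzs; apply/colP => j; rewrite !mxE.
have r0 a : 0 < normc (l a 0).
  by rewrite -ltcR -[X in _ < X]/(`|l a 0|) normr_gt0 l0.
have x0 i : 0 <= moment z i 0 by rewrite mxE mulr_ge0 ?invr_ge0 ?sqr_ge0.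
(* Acting by [l] multiplies the [j]-th moment coordinate by the squared modulus of the [j]-th
   character, so this is the equality of the two levels. *)
have fixed : map_mx intr Q *m
    (\col_j ((\prod_a normc (l a 0) ^ Q a j) ^+ 2 * moment z j 0)) =
    map_mx intr Q *m moment z.
  transitivity (momentQ Q (torus_act Q l z)); last by rewrite lzs.
  congr (_ *m _); apply/colP => i.
  by rewrite !mxE normcM normc_character exprMn mulrCA.
case: (scaling_fixing_image r0 x0 fixed j) => [c1|].
  (* A character value of modulus 1 is unchanged by division by its modulus, and that division
     distributes over the factors [l a 0]. *)
  have norm1 : `|\prod_a l a 0 ^ Q a j| = 1.
    by rewrite -[LHS]/((normc _)%:C) normc_character [X in X%:C]c1.
  rewrite -[X in X * _ = _]divr1 -[X in _ / X]norm1 normr_prod -prodf_div.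
  congr (_ * _); apply: eq_bigr => a _.
  by rewrite mxE expfzMl -expfV normfXz.
(* A zero moment coordinate forces [z j 0 = 0], so both sides vanish whatever the characters are. *)
rewrite mxE => /eqP; rewrite mulf_eq0 invr_eq0 pnatr_eq0 sqrf_eq0/=.
by move=> /eqP/eq0_normc ->; rewrite !mulr0.
Qed.

Lemma U1_orbit_subset l z :
  @U1 R rho l ->
  torus_orbit Q (@U1 R rho) (torus_act Q l z) `<=` torus_orbit Q (@U1 R rho) z.
Proof.
move=> lU _ [m mU <-]; rewrite torus_actM.
by exists (\col_a (m a 0 * l a 0)) => // a; rewrite mxE normrM mU lU mulr1.
Qed.

Lemma U1_orbit_act l z :
  @U1 R rho l ->
  torus_orbit Q (@U1 R rho) (torus_act Q l z) = torus_orbit Q (@U1 R rho) z.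
Proof.
move=> lU; apply/seteqP; split; first exact: U1_orbit_subset.
(* The reverse inclusion is the first one for the inverse element, acting on [torus_act Q l z]. *)
pose l' := \col_a (l a 0)^-1.
have l'U : @U1 R rho l' by move=> a; rewrite mxE normfV lU invr1.
have {1}-> : z = torus_act Q l' (torus_act Q l z).
  rewrite torus_actM -[LHS](torus_act1 Q); congr torus_act.
  by apply/colP => a; rewrite !mxE mulVf// (U1_Cstar lU).
exact: U1_orbit_subset.
Qed.

End Orbits.

Theorem lemma3p2 (R : realType) (rho N : nat) (Q : 'M[int]_(rho, N))
    (s : 'cV[R]_rho) :
  injective (natural_map Q s).
Proof.
move=> O1 O2 eqO; apply: val_inj.
have [z zs ez] := set_valP O1; have [w ws ew] := set_valP O2.
have eqC : torus_orbit Q (@Cstar R rho) z = torus_orbit Q (@Cstar R rho) w.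
  by rewrite -(natural_mapE (esym ez)) -(natural_mapE (esym ew)) eqO.
(* The point [w] lies in its own orbit, by the identity element, hence in that of [z]. *)
have [l l0 lz] : torus_orbit Q (@Cstar R rho) z w.
  rewrite eqC; exists (const_mx 1); last exact: torus_act1.
  by move=> a; rewrite mxE oner_neq0.
(* Replacing [l] by its phase puts [w] in the compact orbit of [z]; it remains to see that the phase
   has modulus 1. *)
rewrite -[LHS]ez -[RHS]ew -lz (level_phase l0 zs) ?lz// U1_orbit_act// => a.
by rewrite mxE normf_div normr_id divff// normr_eq0 l0.
Qed.
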